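(* Let $\Gamma\subseteq\mathbb{R}^n$ be a symmetric, convex, open cone containing the positive cone $\Gamma_+$, and suppose $F$ is a symmetric function on $\Gamma$ that is positive, homogeneous of degree $1$ and monotonically increasing in $\Gamma$. Let $0<r_1<r_2$ and let $G(X,\nu)\in C^\infty\big((B_{r_2}\setminus B_{r_1})\times\mathbb{S}^n\big)$ be a function which is positive if $\langle X,\nu\rangle>0$ and such that, for any fixed unit vector $\nu$, $\frac{\partial}{\partial\rho}(\rho\,G(X,\nu))<0$, where $\rho=|X|$. Then the star-shaped solution $M$ of $$F(\kappa(X))=G(X,\nu(X))\qquad\text{for all }X\in M$$ is unique.
   Context: $M\subset\mathbb{R}^{n+1}$ is a closed hypersurface (in the region where $G$ is defined) with outer unit normal $\nu(X)$ and principal curvatures $\kappa(X)=(\kappa_1,\dots,\kappa_n)\in\Gamma$ at $X\in M$. $\Gamma_+=\{(\kappa_i)\in\mathbb{R}^n:\kappa_i>0\}$. $B_r$ is the ball of radius $r$ centred at the origin in $\mathbb{R}^{n+1}$. $M$ is star-shaped if it is a radial graph over $\mathbb{S}^n$ about the origin, with $\langle X,\nu\rangle>0$. $\partial/\partial\rho$ is the derivative in the radial variable $\rho=|X|$ with $X/|X|$ and $\nu$ fixed. *)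

(* Defs.v *)
From HB Require Import structures.
From mathcomp Require Import all_boot all_order all_algebra all_fingroup.
From mathcomp Require Import all_classical all_reals all_analysis.
Set Implicit Arguments.
Unset Strict Implicit.
Unset Printing Implicit Defensive.
Import Order.TTheory GRing.Theory Num.Theory.
Import numFieldNormedType.Exports.
Local Open Scope classical_set_scope.
Local Open Scope ring_scope.

(* The library's norm on ['rV] is the sup norm, hence the explicit Euclidean
   inner product and norm. *)
Definition inner (R : realType) (m : nat) (u v : 'rV[R]_m) : R :=
  \sum_i u 0 i * v 0 i.

Definition enorm (R : realType) (m : nat) (u : 'rV[R]_m) : R :=
  Num.sqrt (inner u u).

Definition eball (R : realType) (m : nat) (r : R) : set 'rV[R]_m :=
  [set X | enorm X < r].

Definition esphere (R : realType) (m : nat) : set 'rV[R]_m :=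
  [set X | enorm X = 1].

(* C^k on a set U, meant for open U. *)
Fixpoint Ck (R : realType) (V W : normedModType R) (k : nat) (U : set V)
    (f : V -> W) : Prop :=
  match k with
  | 0 => forall x, U x -> {for x, continuous f}
  | k'.+1 => (forall x, U x -> differentiable f x) /\
             (forall v, Ck k' U (fun x => 'd f x v))
  end.

(* Regularity on a set that need not be open: existence of an extension of that
   regularity to an open neighbourhood. The values of f outside A are
   irrelevant. *)
Definition C2_on (R : realType) (V W : normedModType R) (A : set V)
    (f : V -> W) : Prop :=
  exists (U : set V) (g : V -> W),
    [/\ open U, A `<=` U, Ck 2 U g & {in A, f =1 g}].

Definition smooth_on (R : realType) (V W : normedModType R) (A : set V)
    (f : V -> W) : Prop :=
  exists (U : set V) (g : V -> W),
    [/\ open U, A `<=` U, (forall k, Ck k U g) & {in A, f =1 g}].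

(* Derivative of f at x as a function on D: two-sided at interior points of D,
   one-sided at an endpoint that belongs to D. *)
Definition derive_within (R : realType) (D : set R) (f : R -> R) (x : R) : R :=
  lim ((fun h => h^-1 * (f (x + h) - f x)) @
       within [set h | D (x + h)] (0 : R)^').

Section Hypersurfaces.
Variables (R : realType) (n : nat).
Implicit Types (M : set 'rV[R]_n.+1) (X v w : 'rV[R]_n.+1)
  (nu : 'rV[R]_n.+1 -> 'rV[R]_n.+1).

(* Embedded C^2 hypersurface without boundary: locally the zero set of a C^2
   function with nonvanishing differential. *)
Definition hypersurface M : Prop :=
  forall X, M X -> exists (U : set 'rV[R]_n.+1) (f : 'rV[R]_n.+1 -> R),
    [/\ open U, U X, Ck 2 U f, (exists v, 'd f X v != 0) &
        M `&` U = [set Y | U Y /\ f Y = 0]].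

Definition closed_hypersurface M : Prop := compact M /\ hypersurface M.

Definition curve_in M X v (gamma : R -> 'rV[R]_n.+1) : Prop :=
  [/\ gamma 0 = X, (\forall s \near (0 : R), M (gamma s)) &
      is_derive (0 : R) 1 gamma v].

Definition tangent M X v : Prop := exists gamma, curve_in M X v gamma.

(* The union of the unbounded components of the complement of M. *)
Definition outside M : set 'rV[R]_n.+1 :=
  [set X | ~ M X /\ ~ bounded_set (connected_component (~` M) X)].

Definition outer_unit_normal M nu : Prop :=
  forall X, M X ->
    [/\ enorm (nu X) = 1,
        (forall v, tangent M X v -> inner (nu X) v = 0) &
        \forall t \near (0 : R)^'+, outside M (X + t *: nu X)].

(* The differential of nu : M -> S^n at X sends v to w. *)
Definition gauss_differential M nu X v w : Prop :=
  forall gamma, curve_in M X v gamma -> is_derive (0 : R) 1 (nu \o gamma) w.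

(* The eigenvalues, with multiplicity, of the shape operator d nu on the tangent
   space, given through an orthonormal basis of principal directions. With the
   outer normal, the sphere of radius r has all curvatures equal to 1/r. *)
Definition principal_curvatures M nu X (kappa : 'rV[R]_n) : Prop :=
  exists e : 'I_n -> 'rV[R]_n.+1,
    [/\ (forall i, tangent M X (e i)),
        (forall i j, inner (e i) (e j) = (i == j)%:R) &
        (forall i, gauss_differential M nu X (e i) (kappa 0 i *: e i))].

Definition radial_graph M : Prop :=
  exists rho : 'rV[R]_n.+1 -> R,
    [/\ C2_on (@esphere R n.+1) rho,
        (forall z, esphere z -> 0 < rho z) &
        M = [set rho z *: z | z in @esphere R n.+1]].

Definition star_shaped M nu : Prop :=
  radial_graph M /\ forall X, M X -> 0 < inner X (nu X).

Definition positive_cone : set 'rV[R]_n := [set k | forall i, 0 < k 0 i].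

Definition is_cone (Gamma : set 'rV[R]_n) : Prop :=
  forall (t : R) k, 0 < t -> Gamma k -> Gamma (t *: k).

Definition symmetric_set (Gamma : set 'rV[R]_n) : Prop :=
  forall (s : 'S_n) k, Gamma k -> Gamma (col_perm s k).

Definition symmetric_on (Gamma : set 'rV[R]_n) (F : 'rV[R]_n -> R) : Prop :=
  forall (s : 'S_n) k, Gamma k -> F (col_perm s k) = F k.

Definition positive_on (Gamma : set 'rV[R]_n) (F : 'rV[R]_n -> R) : Prop :=
  forall k, Gamma k -> 0 < F k.

Definition homogeneous1_on (Gamma : set 'rV[R]_n) (F : 'rV[R]_n -> R) : Prop :=
  forall (t : R) k, 0 < t -> Gamma k -> F (t *: k) = t * F k.

(* Monotonically increasing in each variable, in the non-strict sense. *)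
Definition increasing_on (Gamma : set 'rV[R]_n) (F : 'rV[R]_n -> R) : Prop :=
  forall k l, Gamma k -> Gamma l -> (forall i, k 0 i <= l 0 i) -> F k <= F l.

Definition annulus (r1 r2 : R) : set 'rV[R]_n.+1 :=
  eball r2 `\` eball r1.

(* d/drho (rho G(X, nu)) at X, with X/|X| and nu fixed; rho = |X| ranges over
   [r1, r2) as X ranges over the annulus. *)
Definition radial_derive (r1 r2 : R) (G : 'rV[R]_n.+1 -> 'rV[R]_n.+1 -> R)
    X (N : 'rV[R]_n.+1) : R :=
  derive_within [set rho | r1 <= rho < r2]
    (fun rho => rho * G ((rho / enorm X) *: X) N) (enorm X).

Definition star_shaped_solution (Gamma : set 'rV[R]_n) (F : 'rV[R]_n -> R)
    (r1 r2 : R) (G : 'rV[R]_n.+1 -> 'rV[R]_n.+1 -> R) M : Prop :=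
  exists nu : 'rV[R]_n.+1 -> 'rV[R]_n.+1,
    [/\ closed_hypersurface M, M `<=` annulus r1 r2, outer_unit_normal M nu,
        star_shaped M nu &
        forall X, M X -> exists kappa : 'rV[R]_n,
          [/\ principal_curvatures M nu X kappa, Gamma kappa &
              F kappa = G X (nu X)]].

End Hypersurfaces.

(* Main.v *)
Require Import Defs.
From mathcomp Require Import all_boot all_order all_algebra all_fingroup.
From mathcomp Require Import all_classical all_reals all_analysis.
From mathcomp Require Import ring.
Set Implicit Arguments.
Unset Strict Implicit.
Unset Printing Implicit Defensive.
Import Order.TTheory GRing.Theory Num.Theory.
Import numFieldNormedType.Exports.
Local Open Scope classical_set_scope.
Local Open Scope ring_scope.

(** Let [X] in [M1] and [T *: X] in [M2] realize the maximal radial ratio [T] of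
    the two graphs, and suppose [T > 1]. Each graph is a level set [h = 1] of
    the function [h] of degree -1 given by [h Y = g (Y/|Y|) / |Y|], and
    [h2 (T *: Y) <= h1 Y] with equality at [X]. The first-order condition gives
    equal normals. The second-order condition, through
    [D^2 h (e_i, w) = - kappa_i <e_i, w> / <nu, X>] for tangent [w], compares the
    shape operators, so the sorted curvatures satisfy [kappa1 <= T kappa2] by
    Weyl monotonicity. Symmetry, monotonicity and homogeneity of [F] then yield
    [G X nu <= T G (T X) nu], against the strict decrease of [rho G]. *)

(** * Inner product and orthonormal frames *)

Section Inner.
Variables (R : realType) (m : nat).
Implicit Types (u v w : 'rV[R]_m) (a : R).

Lemma innerE u v : inner u v = (u *m v^T) 0 0.
Proof. by rewrite mxE; apply: eq_bigr => i _; rewrite mxE. Qed.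

Lemma innerC u v : inner u v = inner v u.
Proof. by apply: eq_bigr => i _; rewrite mulrC. Qed.

Lemma innerDl u v w : inner (u + v) w = inner u w + inner v w.
Proof. by rewrite !innerE mulmxDl mxE. Qed.

Lemma innerDr u v w : inner w (u + v) = inner w u + inner w v.
Proof. by rewrite ![inner w _]innerC innerDl. Qed.

Lemma innerZl a u v : inner (a *: u) v = a * inner u v.
Proof. by rewrite !innerE -scalemxAl mxE. Qed.

Lemma innerZr a u v : inner u (a *: v) = a * inner u v.
Proof. by rewrite innerC innerZl innerC. Qed.

Lemma inner0l v : inner 0 v = 0.
Proof. by rewrite -(scale0r 0) innerZl mul0r. Qed.

Lemma inner_suml (I : Type) (r : seq I) (P : pred I) (f : I -> 'rV[R]_m) v :
  inner (\sum_(i <- r | P i) f i) v = \sum_(i <- r | P i) inner (f i) v.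
Proof.
apply: (big_morph (fun u => inner u v)) => [x y|]; first exact: innerDl.
exact: inner0l.
Qed.

Lemma inner_sumr (I : Type) (r : seq I) (P : pred I) (f : I -> 'rV[R]_m) v :
  inner v (\sum_(i <- r | P i) f i) = \sum_(i <- r | P i) inner v (f i).
Proof. by rewrite innerC inner_suml; apply: eq_bigr => i _; rewrite innerC. Qed.

Lemma inner_ge0 u : 0 <= inner u u.
Proof. by apply: sumr_ge0 => i _; rewrite -expr2 sqr_ge0. Qed.

Lemma inner_eq0 u : (inner u u == 0) = (u == 0).
Proof.
apply/eqP/eqP => [|->]; last exact: inner0l.
move=> /eqP; rewrite psumr_eq0 => [/allP u0|i _]; last by rewrite -expr2 sqr_ge0.
apply/rowP => i; have := u0 i (mem_index_enum _).
by rewrite /= mulf_eq0 orbb mxE => /eqP.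
Qed.

Lemma inner_gt0 u : (0 < inner u u) = (u != 0).
Proof. by rewrite lt_def inner_eq0 inner_ge0 andbT. Qed.

Lemma enorm_gt0 u : (0 < enorm u) = (u != 0).
Proof. by rewrite sqrtr_gt0 inner_gt0. Qed.

Lemma enorm_sqr u : enorm u ^+ 2 = inner u u.
Proof. by rewrite sqr_sqrtr // inner_ge0. Qed.

Lemma enormZ a u : enorm (a *: u) = `|a| * enorm u.
Proof.
by rewrite /enorm innerZl innerZr mulrA -expr2 sqrtrM ?sqr_ge0// sqrtr_sqr.
Qed.

Lemma enorm_normalize u : u != 0 -> enorm ((enorm u)^-1 *: u) = 1.
Proof.
rewrite -enorm_gt0 => u0.
by rewrite enormZ gtr0_norm ?invr_gt0// mulVf// gt_eqF.
Qed.

Lemma esphere_neq0 u : esphere u -> u != 0.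
Proof. by move=> u1; rewrite -enorm_gt0 u1. Qed.

End Inner.

Section Orthonormal.
Variables (R : realType) (n : nat) (N : 'rV[R]_n.+1) (e : 'I_n -> 'rV[R]_n.+1).
Hypothesis N1 : inner N N = 1.
Hypothesis Ne : forall i, inner N (e i) = 0.
Hypothesis ee : forall i j, inner (e i) (e j) = (i == j)%:R.
Implicit Types v w : 'rV[R]_n.+1.

(** The matrix [E] with rows [N] and the [e i] satisfies [E *m E^T = 1]. Being square, it also
    satisfies [E^T *m E = 1], and reading [w *m E^T *m E] row by row gives the expansion. *)
Lemma orthonormal_expansion w :
  w = inner N w *: N + \sum_i inner (e i) w *: e i.
Proof.
pose E : 'M[R]_n.+1 :=
  \matrix_i (if unlift ord0 i is Some j then e j else N).
have E0 : row ord0 E = N by rewrite rowK unlift_none.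
have E1 j : row (lift ord0 j) E = e j by rewrite rowK liftK.
have cE v i : (v *m E^T) 0 i = inner (row i E) v.
  by rewrite mxE; apply: eq_bigr => j _; rewrite !mxE mulrC.
have EE : E *m E^T = 1%:M.
  apply/matrixP => i j.
  have -> : (E *m E^T) i j = inner (row j E) (row i E).
    by rewrite -cE -row_mul [in RHS]mxE.
  rewrite mxE innerC; case: (unliftP ord0 i) => [i' ->|->];
    case: (unliftP ord0 j) => [j' ->|->]; rewrite ?E0 ?E1.
  - by rewrite ee (inj_eq (@lift_inj _ _)).
  - by rewrite innerC Ne.
  - by rewrite Ne.
  - by rewrite N1 eqxx.
have <- : w *m E^T *m E = w by rewrite -mulmxA (mulmx1C EE) mulmx1.
rewrite [LHS]mulmx_sum_row big_ord_recl cE E0.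
rewrite -[w *m E^T *m E]mulmxA (mulmx1C EE) mulmx1.
by congr (_ + _); apply: eq_bigr => i _; rewrite cE E1.
Qed.

Lemma parseval v w : inner N v = 0 ->
  inner v w = \sum_i inner (e i) v * inner (e i) w.
Proof.
move=> Nv; rewrite {1}[v]orthonormal_expansion Nv scale0r add0r inner_suml.
by apply: eq_bigr => i _; rewrite innerZl.
Qed.

End Orthonormal.

(** * Sorted eigenvalues and Weyl monotonicity *)

Lemma sort_perm (R : realType) (n : nat) (k : 'rV[R]_n) :
  exists s : 'S_n, forall i j : 'I_n, (i <= j)%N ->
    col_perm s k 0 i <= col_perm s k 0 j.
Proof.
pose T := [tuple k 0 i | i < n].
have /tuple_permP[s Es] : perm_eq (sort <=%R T) T by rewrite perm_sort.
have nthE (i : 'I_n) : nth 0 (sort <=%R T) i = col_perm s k 0 i.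
  by rewrite Es -tnth_nth !tnth_mktuple mxE.
exists s => i j ij; rewrite -!nthE.
apply: (sorted_leq_nth le_trans lexx) => //.
- exact: (sort_sorted le_total).
- by rewrite inE size_sort size_tuple.
- by rewrite inE size_sort size_tuple.
Qed.

(* Courant-Fischer: at an index [k] violating the conclusion, a dimension count
   gives a nonzero combination of [e_k, ..., e_(n-1)] orthogonal to
   [f_(k+1), ..., f_(n-1)]. *)
Lemma weyl_monotone (R : realType) (n : nat) (N : 'rV[R]_n.+1)
    (e f : 'I_n -> 'rV[R]_n.+1) (a b : 'rV[R]_n) :
  inner N N = 1 ->
  (forall i, inner N (e i) = 0) -> (forall i j, inner (e i) (e j) = (i == j)%:R) ->
  (forall i, inner N (f i) = 0) -> (forall i j, inner (f i) (f j) = (i == j)%:R) ->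
  (forall i j : 'I_n, (i <= j)%N -> a 0 i <= a 0 j) ->
  (forall i j : 'I_n, (i <= j)%N -> b 0 i <= b 0 j) ->
  (forall v, inner N v = 0 ->
    \sum_i a 0 i * inner (e i) v ^+ 2 <= \sum_i b 0 i * inner (f i) v ^+ 2) ->
  forall i, a 0 i <= b 0 i.
Proof.
move=> N1 Ne ee Nf ff a_mon b_mon ab k; rewrite leNgt; apply/negP => ltba.
(* For [x *m A = 0], the columns before [k] say that [x 0 j = 0], and those after [k] that the
   combination of the [e i] is orthogonal to [f j]. Column [k] is zero, so [A] is singular and a
   nonzero [x] exists. *)
pose A : 'M[R]_n := \matrix_(i, j)
  (if (j < k)%N then (i == j)%:R
   else if (k < j)%N then inner (e i) (f j) else 0).
have [x x0 xA] : exists2 x : 'rV[R]_n, x != 0 & x *m A = 0.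
  apply/det0P/eqP; rewrite (expand_det_col A k) big1// => i _.
  by rewrite mxE ltnn mul0r.
have xlt (i : 'I_n) : (i < k)%N -> x 0 i = 0.
  move=> ik; have /matrixP/(_ 0 i) := xA; rewrite !mxE (bigD1 i)//= big1 => [|j ji].
    by rewrite mxE ik eqxx mulr1 addr0.
  by rewrite mxE ik (negPf ji) mulr0.
pose v := \sum_i x 0 i *: e i.
have Nv : inner N v = 0.
  by rewrite inner_sumr big1// => i _; rewrite innerZr Ne mulr0.
have ev i : inner (e i) v = x 0 i.
  rewrite inner_sumr (bigD1 i)//= innerZr ee eqxx mulr1 big1 ?addr0// => j ji.
  by rewrite innerZr ee eq_sym (negPf ji) mulr0.
have fv (j : 'I_n) : (k < j)%N -> inner (f j) v = 0.
  move=> kj; have /matrixP/(_ 0 j) := xA; rewrite !mxE => xAj.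
  rewrite inner_sumr -[RHS]xAj; apply: eq_bigr => i _.
  by rewrite mxE ltnNge (ltnW kj) /= kj innerZr innerC.
have vv_e : inner v v = \sum_i inner (e i) v ^+ 2.
  by rewrite (parseval N1 Ne ee)//; apply: eq_bigr => i _; rewrite expr2.
have vv_f : inner v v = \sum_i inner (f i) v ^+ 2.
  by rewrite (parseval N1 Nf ff)//; apply: eq_bigr => i _; rewrite expr2.
have v_gt0 : 0 < inner v v.
  rewrite inner_gt0; apply: contraNneq x0 => v0.
  apply/eqP/rowP => i; rewrite mxE -ev v0.
  by rewrite innerC inner0l.
(* Only coordinates of index at least [k] survive in the frame [e], and only those of index at most
   [k] in [f]. By Parseval, [a 0 k] and [b 0 k] then bound the two quadratic forms at [v]. *)
have lea : a 0 k * inner v v <= \sum_i a 0 i * inner (e i) v ^+ 2.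
  rewrite vv_e mulr_sumr; apply: ler_sum => i _.
  have [ik|ki] := ltnP i k; first by rewrite ev xlt// expr0n !mulr0.
  by rewrite ler_wpM2r ?sqr_ge0 ?a_mon.
have leb : \sum_i b 0 i * inner (f i) v ^+ 2 <= b 0 k * inner v v.
  rewrite vv_f mulr_sumr; apply: ler_sum => i _.
  have [ki|ik] := ltnP k i; first by rewrite fv// expr0n !mulr0.
  by rewrite ler_wpM2r ?sqr_ge0 ?b_mon.
have := le_trans lea (le_trans (ab v Nv) leb).
by rewrite ler_pM2r// leNgt ltba.
Qed.

(** * Calculus *)

Section Calculus.
Variable R : realType.

Lemma is_derive_along_curve (V W : normedModType R) (f : V -> W) (gamma : R -> V)
    (x : R) (v : V) :
  differentiable f (gamma x) -> is_derive x 1 gamma v ->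
  is_derive x 1 (f \o gamma) ('d f (gamma x) v).
Proof.
move=> df dgamma.
have dg : differentiable gamma x by apply/derivable1_diffP.
have dfg : differentiable (f \o gamma) x by exact: differentiable_comp.
apply: DeriveDef; first exact/derivable1_diffP.
by rewrite deriveE// diff_comp//= -(deriveE _ dg) derive_val.
Qed.

Lemma diff_of_is_derive (V W : normedModType R) (f : V -> W) (x v : V) (d : W) :
  differentiable f x -> is_derive x v f d -> 'd f x v = d.
Proof. by move=> df dfv; rewrite -deriveE// derive_val. Qed.

Lemma is_derive_of_diff (V W : normedModType R) (f : V -> W) (x v : V) :
  differentiable f x -> is_derive x v f ('d f x v).
Proof. by move=> df; rewrite -deriveE//; exact/derivableP/diff_derivable. Qed.

Lemma diff_mul (V : normedModType R) (f g : V -> R) (x v : V) :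
  differentiable f x -> differentiable g x ->
  'd (fun y => f y * g y) x v = f x * 'd g x v + g x * 'd f x v.
Proof. by move=> df dg; rewrite (diffM df dg). Qed.

Lemma diff_compE (V W Z : normedModType R) (f : V -> W) (g : W -> Z) (x v : V) :
  differentiable f x -> differentiable g (f x) ->
  'd (fun y => g (f y)) x v = 'd g (f x) ('d f x v).
Proof. by move=> df dg; rewrite (diff_comp df dg). Qed.

Lemma is_derive_line (V : normedModType R) (x v : V) (s : R) :
  is_derive s 1 (fun s => x + s *: v) v.
Proof.
have dl : is_derive s 1 ( *:%R^~ v : R -> V) v.
  have [df dE] := is_diff_scalel s v.
  by have := is_derive_of_diff (1 : R) df; rewrite dE scale1r.
by rewrite -[X in is_derive _ _ _ X]add0r; apply: is_deriveD.
Qed.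

(** Fermat's theorem gives [k' 0 = 0]. If [c > 0], the difference quotient makes [k'] positive just
    to the right of 0, and the mean value theorem yields a value of [k] above [k 0].
    Differentiability of [k'] is needed at 0 only. *)
Lemma second_derivative_test (k k' : R -> R) (c : R) :
  (\forall s \near (0 : R), is_derive (s : R) 1 k (k' s)) ->
  (\forall s \near (0 : R), k s <= k 0) ->
  is_derive (0 : R) 1 k' c -> k' 0 = 0 /\ c <= 0.
Proof.
move=> dk kmax dk'.
have /nbhs_ballP[d /= d0 dP] : \forall s \near (0 : R),
    is_derive (s : R) 1 k (k' s) /\ k s <= k 0 by near=> s; split; near: s.
have {}dP s : `|s| < d -> is_derive (s : R) 1 k (k' s) /\ k s <= k 0.
  by move=> sd; apply: dP; rewrite /ball/= sub0r normrN.
have k'0 : k' 0 = 0.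
  have [dk0 _] : is_derive (0 : R) 1 k (k' 0) /\ k 0 <= k 0.
    by apply: dP; rewrite normr0.
  have dle : - d <= d by rewrite (@le_trans _ _ 0)// ?oppr_le0 ltW.
  have : is_derive (0 : R) 1 k 0.
    apply: (derive1_at_max dle) => [t| |t].
    - by rewrite in_itv/= -ltr_norml => /dP[[]].
    - by rewrite in_itv/= oppr_lt0 d0.
    - by rewrite in_itv/= -ltr_norml => /dP[].
  by case: dk0 => _ <- [_ ->].
split=> //; rewrite leNgt; apply/negP => c0.
case: dk' => dk'0 dk'c.
have : (fun h : R => h^-1 *: (k' (h *: 1 + 0) - k' 0)) @ (0 : R)^' --> c.
  by rewrite -dk'c; exact: dk'0.
move/cvgr_gt => /(_ 0 c0)/nbhs_ballP[e /= e0 eP].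
pose m := Num.min d e; have m0 : 0 < m by rewrite lt_min d0.
have m2 : 0 < m / 2 by rewrite divr_gt0.
have m2m : m / 2 < m by rewrite gtr_pMr// invf_lt1// ltr1n.
have m2d : m / 2 < d by rewrite (lt_le_trans m2m)// ge_min lexx.
have m2e : m / 2 < e by rewrite (lt_le_trans m2m)// ge_min lexx orbT.
have dkI s : s \in `[0, m / 2]%R -> is_derive (s : R) 1 k (k' s).
  rewrite in_itv/= => /andP[s0 sm]; apply: (dP _ _).1.
  by rewrite ger0_norm// (le_lt_trans sm).
have [s /[!in_itv]/= /andP[s0 sm] ks] := MVT m2
  (fun s hs => dkI s (subset_itv_oo_cc hs))
  (derivable_within_continuous (fun s hs => @ex_derive _ _ _ _ _ _ _ (dkI s hs))).
have : 0 < s^-1 *: (k' (s *: 1 + 0) - k' 0).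
  apply: eP; last by rewrite gt_eqF.
  by rewrite /ball/= sub0r normrN gtr0_norm// (lt_trans sm).
rewrite k'0 subr0 addr0 [_%:A]mulr1 [_ *: _]/(_ * _) pmulr_rgt0 ?invr_gt0// => k's.
have [_] := dP (m / 2) ltac:(by rewrite gtr0_norm).
by rewrite -subr_le0 ks subr0 leNgt mulr_gt0.
Unshelve. all: by end_near. Qed.

End Calculus.

(** * Differentials of the Euclidean norm and of the projection to the sphere *)

Section RadialProjection.
Variables (R : realType) (m : nat).
Implicit Types (u v w x y : 'rV[R]_m).

Lemma is_derive_coord x v (i : 'I_m) :
  is_derive x v (fun y => y 0 i : R) (v 0 i).
Proof.
apply: DeriveDef; first exact/diff_derivable/differentiable_coord.
have := derive_mx (@derivable_id _ _ x v).
by rewrite derive_id => /rowP/(_ i); rewrite mxE.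
Qed.

Lemma differentiable_inner u x : differentiable (inner u) x.
Proof.
have -> : inner u = \sum_i (fun v => u 0 i * v 0 i).
  by apply/funext => v; rewrite fct_sumE.
apply: differentiable_sum => i.
by apply: differentiableM => //; exact: differentiable_coord.
Qed.

Lemma diff_inner u x v : 'd (inner u) x v = inner u v.
Proof.
apply: diff_of_is_derive; first exact: differentiable_inner.
have E : inner u = \sum_i (fun v => u 0 i * v 0 i).
  by apply/funext => w; rewrite fct_sumE.
rewrite {1}E; apply: is_derive_sum => i.
have dc := is_derive_coord x v i.
have := @is_deriveM _ _ (cst (u 0 i)) _ x v _ _ (is_derive_cst _ _ _) dc.
by rewrite scaler0 addr0.
Qed.

Lemma is_derive_inner u (gamma : R -> 'rV[R]_m) (s : R) v :
  is_derive s 1 gamma v -> is_derive s 1 (fun s => inner u (gamma s)) (inner u v).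
Proof.
move=> dg; rewrite -(diff_inner u (gamma s)).
by apply: is_derive_along_curve => //; exact: differentiable_inner.
Qed.

Lemma differentiable_inner_sqr x : differentiable (fun y => inner y y) x.
Proof.
have -> : (fun y => inner y y) = \sum_i (fun y : 'rV[R]_m => y 0 i * y 0 i).
  by apply/funext => v; rewrite fct_sumE.
by apply: differentiable_sum => i; apply: differentiableM; exact: differentiable_coord.
Qed.

Lemma diff_inner_sqr x v : 'd (fun y => inner y y) x v = 2 * inner x v.
Proof.
apply: diff_of_is_derive; first exact: differentiable_inner_sqr.
have -> : (fun y => inner y y) = \sum_i (fun y : 'rV[R]_m => y 0 i * y 0 i).
  by apply/funext => w; rewrite fct_sumE.
rewrite mulr_sumr; apply: is_derive_sum => i.
have dc := is_derive_coord x v i.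
apply: (is_derive_eq (is_deriveM dc dc)).
by rewrite [RHS]mulr_natl.
Qed.

Lemma differentiable_enorm x : x != 0 -> differentiable (@enorm R m) x.
Proof.
move=> x0; apply: (@differentiable_comp _ _ _ _ (fun y => inner y y) Num.sqrt).
  exact: differentiable_inner_sqr.
apply/derivable1_diffP; have x1 : 0 < inner x x by rewrite inner_gt0.
by case: (is_derive1_sqrt x1).
Qed.

Lemma diff_enorm x v : x != 0 -> 'd (@enorm R m) x v = (enorm x)^-1 * inner x v.
Proof.
move=> x0; have x1 : 0 < inner x x by rewrite inner_gt0.
have ds := is_derive1_sqrt x1.
have dsq : differentiable (@Num.sqrt R) (inner x x) by apply/derivable1_diffP; case: ds.
rewrite (diff_comp (differentiable_inner_sqr x) dsq) /=.
rewrite diff_inner_sqr diff1E// derive1E derive_val.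
transitivity (2 * inner x v * (2 * enorm x)^-1) => //.
by rewrite invfM mulrACA divff// mul1r mulrC.
Qed.

Lemma differentiable_enormV x : x != 0 -> differentiable (fun y => (enorm y)^-1) x.
Proof.
move=> x0; apply: differentiableV; first exact: differentiable_enorm.
by rewrite gt_eqF// enorm_gt0.
Qed.

Lemma diff_enormV x v : x != 0 ->
  'd (fun y => (enorm y)^-1) x v = - ((enorm x)^-1 ^+ 3 * inner x v).
Proof.
move=> x0; rewrite diffV; [|exact: differentiable_enorm|by rewrite gt_eqF// enorm_gt0].
transitivity (- (enorm x) ^- 2 * 'd (@enorm R m) x v) => //.
by rewrite diff_enorm// mulNr mulrA -exprVn -exprSr.
Qed.

Definition sphere_proj y := (enorm y)^-1 *: y.

Lemma esphere_proj x : x != 0 -> esphere (sphere_proj x).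
Proof. exact: enorm_normalize. Qed.

(** Written as a sum of scalar functions times fixed vectors, the projection can be differentiated
    with the rules for real-valued products. *)
Lemma sphere_projE : sphere_proj =
  \sum_i (fun y : 'rV[R]_m => ((enorm y)^-1 * y 0 i) *: delta_mx 0 i).
Proof.
apply/funext => y; rewrite fct_sumE /sphere_proj {2}[y]row_sum_delta scaler_sumr.
by apply: eq_bigr => i _; rewrite scalerA.
Qed.

Lemma differentiable_sphere_proj x : x != 0 -> differentiable sphere_proj x.
Proof.
move=> x0; rewrite sphere_projE; apply: differentiable_sum => i.
apply: differentiableZl; apply: differentiableM; last exact: differentiable_coord.
exact: differentiable_enormV.
Qed.

Lemma diff_sphere_proj x v : x != 0 ->
  'd sphere_proj x v
    = (enorm x)^-1 *: v - ((enorm x)^-1 ^+ 3 * inner x v) *: x.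
Proof.
move=> x0; apply: diff_of_is_derive; first exact: differentiable_sphere_proj.
set c := _ * inner x v.
have -> : (enorm x)^-1 *: v - c *: x = \sum_i ((enorm x)^-1 *:
    (v 0 i *: delta_mx 0 i) - c *: (x 0 i *: delta_mx 0 i)).
  by rewrite sumrB -!scaler_sumr -!row_sum_delta.
rewrite sphere_projE.
apply: is_derive_sum => i.
have dq : differentiable (fun y => (enorm y)^-1) x by exact: differentiable_enormV.
have dc := differentiable_coord x 0 i.
have dqc : differentiable (fun y : 'rV[R]_m => (enorm y)^-1 * y 0 i) x.
  exact: differentiableM.
have -> : (enorm x)^-1 *: (v 0 i *: delta_mx 0 i) - c *: (x 0 i *: delta_mx 0 i) =
    'd (fun y : 'rV[R]_m => ((enorm y)^-1 * y 0 i) *: (delta_mx 0 i : 'rV[R]_m)) x v.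
  rewrite diffZl// (diff_mul _ dq dc) diff_enormV// -/c.
  rewrite (diff_of_is_derive dc (is_derive_coord x v i)).
  by rewrite !scalerA -scalerBl mulrN (mulrC (x 0 i)).
apply: is_derive_of_diff; exact: differentiableZl.
Qed.

End RadialProjection.

Lemma linear_rowE (R : realType) (m : nat) (L : {linear 'rV[R]_m -> R}) v :
  L v = \sum_i v 0 i * L (delta_mx 0 i).
Proof.
by rewrite {1}[v]row_sum_delta linear_sum; apply: eq_bigr => i _; rewrite linearZ.
Qed.

(** * The extension of a radial function, homogeneous of degree -1 *)

Section RadialFunction.
Variables (R : realType) (m : nat) (U : set 'rV[R]_m) (g : 'rV[R]_m -> R).
Hypothesis sphereU : @esphere R m `<=` U.
Hypothesis g_C2 : Ck 2 U g.
Implicit Types (v w x y : 'rV[R]_m).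

(* Homogeneous of degree -1; equal to 1 exactly on the radial graph of [g]. *)
Definition radial_fun y := (enorm y)^-1 * g (sphere_proj y).

(** The closed form of ['d (radial_fun g) y w] for nonzero [y]. The differential of [g] in the
    moving direction [y] is split into coordinates, so that only differentials in fixed directions
    occur; these are what [Ck 2] makes differentiable. *)
Definition radial_grad w y : R :=
  (enorm y)^-1 ^+ 2 * 'd g (sphere_proj y) w
  - (enorm y)^-1 ^+ 3 * inner w y * (g (sphere_proj y)
     + (enorm y)^-1 * \sum_i y 0 i * 'd g (sphere_proj y) (delta_mx 0 i)).

Lemma radial_funZ (t : R) y : 0 < t -> radial_fun (t *: y) = t^-1 * radial_fun y.
Proof.
move=> t0; rewrite /radial_fun /sphere_proj enormZ gtr0_norm// invfM scalerA.
by rewrite -mulrA [_ / _ * t]mulrAC mulVf ?gt_eqF// mul1r.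
Qed.

Lemma radial_fun_sphere z : esphere z -> radial_fun z = g z.
Proof. by move=> z1; rewrite /radial_fun /sphere_proj z1 invr1 scale1r mul1r. Qed.

Let dg x : x != 0 -> differentiable g (sphere_proj x).
Proof. by move=> x0; apply: g_C2.1; exact/sphereU/esphere_proj. Qed.

Let dgp x : x != 0 -> differentiable (g \o @sphere_proj R m) x.
Proof.
move=> x0; apply: differentiable_comp; first exact: differentiable_sphere_proj.
exact: dg.
Qed.

Lemma differentiable_radial_fun x : x != 0 -> differentiable radial_fun x.
Proof.
move=> x0; apply: differentiableM; last exact: dgp.
exact: differentiable_enormV.
Qed.

Lemma diff_radial_fun x w : x != 0 -> 'd radial_fun x w = radial_grad w x.
Proof.
move=> x0; rewrite (diff_mul _ (differentiable_enormV x0) (dgp x0)).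
rewrite diff_enormV//.
have -> := diff_compE w (differentiable_sphere_proj x0) (dg x0).
have LE (L : {linear 'rV[R]_m -> R}) a b : L (a *: w - b *: x) = a * L w - b * L x.
  by rewrite linearB 2!linearZ.
rewrite diff_sphere_proj// LE /radial_grad (linear_rowE ('d g (sphere_proj x)) x).
rewrite (innerC w x).
have ringE (r G I a b : R) : r * (r * a - r ^+ 3 * I * b) + G * - (r ^+ 3 * I) =
    r ^+ 2 * a - r ^+ 3 * I * (G + r * b) by ring.
exact: ringE.
Qed.

Lemma differentiable_radial_grad x w : x != 0 -> differentiable (radial_grad w) x.
Proof.
move=> x0.
have dq : differentiable (fun y => (enorm y)^-1) x by exact: differentiable_enormV.
have ddg v : differentiable (fun y => 'd g (sphere_proj y) v) x.
  apply: (@differentiable_comp _ _ _ _ (@sphere_proj R m) (fun y => 'd g y v)).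
    exact: differentiable_sphere_proj.
  by apply: (g_C2.2 v).1; exact/sphereU/esphere_proj.
have dqX k : differentiable (fun y => (enorm y)^-1 ^+ k.+1) x.
  have -> : (fun y => (enorm y)^-1 ^+ k.+1) =
      (fun y : 'rV[R]_m => (enorm y)^-1) ^+ k.+1.
    by apply/funext => y; rewrite exprfctE.
  exact: differentiableX.
apply: differentiableB; first exact: differentiableM.
apply: differentiableM.
  by apply: differentiableM => //; exact: differentiable_inner.
apply: differentiableD; first exact: dgp.
apply: differentiableM => //.
have -> : (fun y => \sum_i y 0 i * 'd g (sphere_proj y) (delta_mx 0 i)) =
    \sum_i (fun y : 'rV[R]_m => y 0 i * 'd g (sphere_proj y) (delta_mx 0 i)).
  by apply/funext => y; rewrite fct_sumE.
apply: differentiable_sum => i; apply: differentiableM => //.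
exact: differentiable_coord.
Qed.

(** Euler's identity in degree -1. In the closed form, [inner x x] is [enorm x ^+ 2], and the two
    terms with the differential of [g] cancel. *)
Lemma radial_grad_euler x : x != 0 -> radial_grad x x = - radial_fun x.
Proof.
move=> x0; rewrite /radial_grad /radial_fun (linear_rowE ('d g (sphere_proj x)) x).
have e0 : enorm x != 0 by rewrite gt_eqF// enorm_gt0.
by rewrite -enorm_sqr; field.
Qed.

End RadialFunction.

(** * Curvature of a radial level set *)

Section LevelSet.
Variables (R : realType) (n : nat) (M U : set 'rV[R]_n.+1).
Variables (nu : 'rV[R]_n.+1 -> 'rV[R]_n.+1) (g : 'rV[R]_n.+1 -> R).
Hypothesis sphereU : @esphere R n.+1 `<=` U.
Hypothesis g_C2 : Ck 2 U g.
Hypothesis M_level : forall Y, M Y -> Y != 0 /\ radial_fun g Y = 1.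
Hypothesis nu_unit : forall Y, M Y -> inner (nu Y) (nu Y) = 1.
Hypothesis nu_normal : forall Y v, M Y -> tangent M Y v -> inner (nu Y) v = 0.
Hypothesis M_curved : forall Y, M Y -> exists kappa, principal_curvatures M nu Y kappa.
Implicit Types (X Y v w e : 'rV[R]_n.+1).

(** Along a curve in [M] the function [radial_fun g] is constantly 1. *)
Lemma radial_grad_tangent Y v : M Y -> tangent M Y v -> radial_grad g v Y = 0.
Proof.
move=> MY [gamma [g0 gM dgamma]]; subst Y; have [Y0 hY] := M_level MY.
rewrite -(diff_radial_fun sphereU g_C2)//.
have dh : differentiable (radial_fun g) (gamma 0).
  exact: (differentiable_radial_fun sphereU g_C2).
transitivity ('D_1 (radial_fun g \o gamma) (0 : R)).
  by case: (is_derive_along_curve dh dgamma).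
rewrite -[RHS](derive_cst (1 : R) (0 : R) 1); apply: near_eq_derive.
by near=> s => /=; apply: (M_level _).2; near: s.
Unshelve. all: by end_near. Qed.

(** The principal directions and [nu Y] form an orthonormal basis, and the gradient kills the
    principal directions, which are tangent. Only the normal component of [w] contributes. *)
Lemma radial_grad_normal Y w : M Y ->
  radial_grad g w Y = inner (nu Y) w * radial_grad g (nu Y) Y.
Proof.
move=> MY; have [kappa [e [eT ee _]]] := M_curved MY.
have Ne i : inner (nu Y) (e i) = 0 by exact: nu_normal.
rewrite -!(diff_radial_fun sphereU g_C2) ?(M_level MY).1//.
rewrite {1}(orthonormal_expansion (nu_unit MY) Ne ee w) linearD linear_sum.
rewrite big1 => [|i _]; last first.
  by rewrite linearZ (diff_radial_fun sphereU g_C2) ?(M_level MY).1//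
    radial_grad_tangent// [LHS]mulr0.
by rewrite /= addr0 linearZ.
Qed.

(** Euler's identity at [w = Y] fixes the normal factor: the gradient is [- nu Y] divided by the
    support function [inner (nu Y) Y]. The product form avoids the division. *)
Lemma radial_grad_support Y w : M Y ->
  radial_grad g w Y * inner (nu Y) Y = - inner (nu Y) w.
Proof.
move=> MY; have [Y0 hY] := M_level MY.
have := radial_grad_normal Y MY.
rewrite radial_grad_euler// hY => gY.
by rewrite radial_grad_normal// mulrAC -mulrA -gY mulrN1.
Qed.

(* Differentiate [grad w <nu, X> = grad X <nu, w>] along a curve on the level
   set, where [X] and [w] are fixed. *)
Lemma radial_hessian_principal X e w (k : R) : M X -> tangent M X e ->
  gauss_differential M nu X e (k *: e) -> inner (nu X) w = 0 ->
  'd (radial_grad g w) X e * inner (nu X) X = - (k * inner e w).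
Proof.
move=> MX [gamma cg] gd nw; have [X0 hX] := M_level MX.
have dnu := gd gamma cg; have [g0 gM dgamma] := cg; subst X.
have dgrad v : is_derive (0 : R) 1 (fun s => radial_grad g v (gamma s))
    ('d (radial_grad g v) (gamma 0) e).
  apply: is_derive_along_curve => //.
  exact: (differentiable_radial_grad sphereU g_C2).
have din v : is_derive (0 : R) 1 (fun s => inner v (nu (gamma s))) (inner v (k *: e)).
  exact: (@is_derive_inner _ _ v (nu \o gamma)).
have [_ dl] := is_deriveM (dgrad w) (din (gamma 0)).
have [_ dr] := is_deriveM (dgrad (gamma 0)) (din w).
(* At the base point the gradient along [w] and [inner w nu] both vanish, which removes one
   product-rule term on each side. Euler's identity supplies the factor -1 of the remaining term on
   the right. *)
have gradw : radial_grad g w (gamma 0) = 0 by rewrite radial_grad_normal// nw mul0r.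
have gradX : radial_grad g (gamma 0) (gamma 0) = -1 by rewrite radial_grad_euler// hX.
have cross Y : M Y -> radial_grad g w Y * inner (gamma 0) (nu Y) =
    radial_grad g (gamma 0) Y * inner w (nu Y).
  move=> MY; rewrite (radial_grad_normal w MY) (radial_grad_normal (gamma 0) MY).
  rewrite !(innerC _ (nu Y)); ring.
have lr : 'D_1 ((fun s => radial_grad g w (gamma s)) *
                (fun s => inner (gamma 0) (nu (gamma s)))) (0 : R) =
          'D_1 ((fun s => radial_grad g (gamma 0) (gamma s)) *
                (fun s => inner w (nu (gamma s)))) (0 : R).
  apply: near_eq_derive; near=> s.
  by apply: cross; near: s.
move: lr; rewrite dl dr gradw gradX (innerC w (nu _)) nw !scale0r addr0 add0r.
by rewrite scaleN1r innerZr (innerC w) (innerC (gamma 0)) [_ *: _]mulrC.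
Unshelve. all: by end_near. Qed.

Lemma radial_hessian_quadratic X (kappa : 'rV[R]_n) (e : 'I_n -> 'rV[R]_n.+1) v :
  M X -> (forall i, tangent M X (e i)) ->
  (forall i j, inner (e i) (e j) = (i == j)%:R) ->
  (forall i, gauss_differential M nu X (e i) (kappa 0 i *: e i)) ->
  inner (nu X) v = 0 ->
  'd (radial_grad g v) X v * inner (nu X) X
    = - \sum_i kappa 0 i * inner (e i) v ^+ 2.
Proof.
move=> MX eT ee gd nv.
have Ne i : inner (nu X) (e i) = 0 by exact: nu_normal.
have vE : v = \sum_i inner (e i) v *: e i.
  by rewrite {1}(orthonormal_expansion (nu_unit MX) Ne ee v) nv scale0r add0r.
have -> : 'd (radial_grad g v) X v =
    \sum_i inner (e i) v * 'd (radial_grad g v) X (e i).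
  (* Only the direction of differentiation is expanded in the frame; the [v] inside
     [radial_grad g v] stays fixed and plays the role of [w] in [radial_hessian_principal]. *)
  rewrite [LHS](_ : _ = 'd (radial_grad g v) X (\sum_i inner (e i) v *: e i)).
    by rewrite linear_sum; apply: eq_bigr => i _; rewrite linearZ.
  by rewrite -vE.
rewrite mulr_suml -sumrN; apply: eq_bigr => i _.
rewrite -mulrA (radial_hessian_principal MX (eT i) (gd i) nv).
ring.
Qed.

End LevelSet.

(** The geometric data of a solution that the touching argument consumes. The equation is left out,
    since normals and curvatures are compared before [F] and [G] enter. *)
Record radial_level_set (R : realType) (n : nat) (M : set 'rV[R]_n.+1)
    (nu : 'rV[R]_n.+1 -> 'rV[R]_n.+1) (U : set 'rV[R]_n.+1) (g : 'rV[R]_n.+1 -> R) :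
    Prop := RadialLevelSet {
  level_sphere : @esphere R n.+1 `<=` U;
  level_C2 : Ck 2 U g;
  level_eq1 : forall Y, M Y -> Y != 0 /\ radial_fun g Y = 1;
  level_unit : forall Y, M Y -> inner (nu Y) (nu Y) = 1;
  level_normal : forall Y v, M Y -> tangent M Y v -> inner (nu Y) v = 0;
  level_curved : forall Y, M Y -> exists kappa, principal_curvatures M nu Y kappa;
  level_star : forall Y, M Y -> 0 < inner Y (nu Y) }.

(** * First- and second-order comparison at a touching point *)

Section Touching.
Variables (R : realType) (n : nat) (M1 M2 U1 U2 : set 'rV[R]_n.+1).
Variables (nu1 nu2 : 'rV[R]_n.+1 -> 'rV[R]_n.+1) (g1 g2 : 'rV[R]_n.+1 -> R).
Hypothesis L1 : radial_level_set M1 nu1 U1 g1.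
Hypothesis L2 : radial_level_set M2 nu2 U2 g2.
Variables (X : 'rV[R]_n.+1) (t : R).
Hypotheses (t_gt0 : 0 < t) (M1X : M1 X) (M2tX : M2 (t *: X)).
Hypothesis inside : forall Y, Y != 0 -> radial_fun g2 (t *: Y) <= radial_fun g1 Y.
Implicit Types v : 'rV[R]_n.+1.

(** By [inside], the surface [M2] scaled by [t^-1] lies inside [M1] and touches it at [X]. On the
    line through [X] in direction [v], the difference of the two level functions has its maximum 0
    at [X], so the second derivative test applies. *)
Lemma touching_derivatives v :
  radial_grad g2 (t *: v) (t *: X) = radial_grad g1 v X /\
  'd (radial_grad g2 (t *: v)) (t *: X) (t *: v) <= 'd (radial_grad g1 v) X v.
Proof.
have [X0 h1X] := level_eq1 L1 M1X; have [tX0 h2X] := level_eq1 L2 M2tX.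
have line0 (Y w : 'rV[R]_n.+1) : Y + 0 *: w = Y by rewrite scale0r addr0.
have nearX : \forall s \near (0 : R), X + s *: v != 0.
  have cl : {for (0 : R), continuous (fun s : R => X + s *: v)}.
    apply: differentiable_continuous; apply/derivable1_diffP.
    by case: (is_derive_line X v 0).
  by apply: (cvgr_neq0 _ cl); rewrite line0.
have lineZ s : t *: X + s *: (t *: v) = t *: (X + s *: v).
  by rewrite scalerDr !scalerA mulrC.
pose k s := radial_fun g2 (t *: X + s *: (t *: v)) - radial_fun g1 (X + s *: v).
pose k' s := radial_grad g2 (t *: v) (t *: X + s *: (t *: v))
  - radial_grad g1 v (X + s *: v).
have dk : \forall s \near (0 : R), is_derive (s : R) 1 k (k' s).
  near=> s; have Xs : X + s *: v != 0 by near: s.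
  have tXs : t *: X + s *: (t *: v) != 0.
    by rewrite lineZ scaler_eq0 gt_eqF.
  rewrite /k' -(diff_radial_fun (level_sphere L2) (level_C2 L2))//.
  rewrite -(diff_radial_fun (level_sphere L1) (level_C2 L1))//.
  apply: is_deriveB; apply: is_derive_along_curve; try exact: is_derive_line.
  - exact: (differentiable_radial_fun (level_sphere L2) (level_C2 L2)).
  - exact: (differentiable_radial_fun (level_sphere L1) (level_C2 L1)).
have kmax : \forall s \near (0 : R), k s <= k 0.
  near=> s; have Xs : X + s *: v != 0 by near: s.
  by rewrite /k !line0 h1X h2X subrr lineZ subr_le0 inside.
have d2 := differentiable_radial_grad (level_sphere L2) (level_C2 L2) (t *: v) tX0.
have d1 := differentiable_radial_grad (level_sphere L1) (level_C2 L1) v X0.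
have along (Y w : 'rV[R]_n.+1) (f : 'rV[R]_n.+1 -> R) : differentiable f Y ->
    is_derive (0 : R) 1 (fun s => f (Y + s *: w)) ('d f Y w).
  (* The base point is generalized because [Y + 0 *: w] equals [Y] only propositionally, while the
     chain rule produces the former. *)
  suff gen Z : Z = Y + 0 *: w -> differentiable f Z ->
      is_derive (0 : R) 1 (fun s => f (Y + s *: w)) ('d f Z w) by exact/gen/esym.
  by move=> -> df; exact: (is_derive_along_curve df (is_derive_line _ _ _)).
have [k'0 c0] :=
  second_derivative_test dk kmax (is_deriveB (along _ _ _ d2) (along _ _ _ d1)).
split; last by rewrite -subr_le0.
by move: k'0; rewrite /k' !line0; exact: subr0_eq.
Unshelve. all: by end_near. Qed.

(** Equal gradients make the normals proportional. Both have unit length and positive product with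
    [X], so they coincide. *)
Lemma touching_normal : nu2 (t *: X) = nu1 X.
Proof.
have p0 := level_star L1 M1X; have q0 := level_star L2 M2tX.
rewrite innerC in p0; rewrite innerC innerZr pmulr_rgt0// in q0.
set N := nu1 X in p0 *; set P := nu2 (t *: X) in q0 *.
have cross v : inner P v * inner N X = inner N v * inner P X.
  have [gE _] := touching_derivatives v.
  have s1 := radial_grad_support (level_sphere L1) (level_C2 L1) (level_eq1 L1)
    (level_unit L1) (level_normal L1) (level_curved L1) v M1X.
  have s2 := radial_grad_support (level_sphere L2) (level_C2 L2) (level_eq1 L2)
    (level_unit L2) (level_normal L2) (level_curved L2) (t *: v) M2tX.
  rewrite -/N in s1; rewrite -/P gE !innerZr in s2.
  apply: (mulfI (lt0r_neq0 t_gt0)).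
  rewrite mulrA -[t * inner P v]opprK -s2 -[inner N v]opprK -s1; ring.
have NN : inner N N = 1 by exact: (level_unit L1).
have PP : inner P P = 1 by exact: (level_unit L2).
(* Using [cross] at [N] and then at [P] gives [inner N P ^+ 2 * inner N X = inner N X], and
   [inner N X] is positive. *)
have c1 : inner N P ^+ 2 = 1.
  apply: (mulIf (lt0r_neq0 p0)); rewrite mul1r expr2 -mulrA.
  have := cross N; rewrite NN mul1r innerC => ->.
  by rewrite -cross PP mul1r.
have c0 : 0 < inner N P.
  by have := cross N; rewrite NN mul1r innerC => qE; move: q0; rewrite -qE pmulr_lgt0.
have {c1 c0} c1 : inner N P = 1.
  by apply/eqP; rewrite -(@eqrXn2 _ 2) ?ltW// c1 expr1n.
apply/eqP; rewrite -subr_eq0 -inner_eq0 -scaleN1r innerDl !innerDr !innerZl !innerZr.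
rewrite NN PP (innerC P) c1; apply/eqP; ring.
Qed.

(** Multiplied by the positive support function, the Hessian inequality says that the second
    fundamental form of [M1] is at most [t] times that of [M2] on the common tangent space. Sorting
    the curvatures along with their frames makes [weyl_monotone] applicable. *)
Lemma touching_curvatures (k1 k2 : 'rV[R]_n) :
  principal_curvatures M1 nu1 X k1 -> principal_curvatures M2 nu2 (t *: X) k2 ->
  exists s1 s2 : 'S_n, forall i, col_perm s1 k1 0 i <= (t *: col_perm s2 k2) 0 i.
Proof.
move=> [e [eT ee egd]] [f [fT ff fgd]].
have [s1 s1_mon] := sort_perm k1; have [s2 s2_mon] := sort_perm k2.
exists s1, s2.
have nuE := touching_normal.
have Ne i : inner (nu1 X) (e i) = 0 by exact: (level_normal L1).
have Nf i : inner (nu1 X) (f i) = 0 by rewrite -nuE; exact: (level_normal L2).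
apply: (@weyl_monotone _ _ (nu1 X) (e \o s1) (f \o s2)) => //=.
- exact: (level_unit L1).
- by move=> i j; rewrite ee (inj_eq perm_inj).
- by move=> i j; rewrite ff (inj_eq perm_inj).
- by move=> i j ij; rewrite !mxE ler_pM2l//; have := s2_mon i j ij; rewrite !mxE.
move=> v Nv.
have -> : \sum_i col_perm s1 k1 0 i * inner (e (s1 i)) v ^+ 2 =
    \sum_i k1 0 i * inner (e i) v ^+ 2.
  by rewrite [RHS](reindex_inj (@perm_inj _ s1)); apply: eq_bigr => i _; rewrite mxE.
have -> : \sum_i (t *: col_perm s2 k2) 0 i * inner (f (s2 i)) v ^+ 2 =
    t * \sum_i k2 0 i * inner (f i) v ^+ 2.
  rewrite [in RHS](reindex_inj (@perm_inj _ s2)) mulr_sumr.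
  by apply: eq_bigr => i _; rewrite !mxE mulrA.
have p0 := level_star L1 M1X; rewrite innerC in p0.
have [_ hess] := touching_derivatives v.
have q1 := radial_hessian_quadratic (level_sphere L1) (level_C2 L1) (level_eq1 L1)
  (level_unit L1) (level_normal L1) (level_curved L1) M1X eT ee egd Nv.
have Ntv : inner (nu2 (t *: X)) (t *: v) = 0 by rewrite nuE innerZr Nv mulr0.
have q2 := radial_hessian_quadratic (level_sphere L2) (level_C2 L2) (level_eq1 L2)
  (level_unit L2) (level_normal L2) (level_curved L2) M2tX fT ff fgd Ntv.
(* The direction [t *: v] contributes [t ^+ 2], and the support function at [t *: X] takes one [t]
   back, leaving the single factor [t]. *)
have tsum : \sum_i k2 0 i * inner (f i) (t *: v) ^+ 2 =
    t ^+ 2 * \sum_i k2 0 i * inner (f i) v ^+ 2.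
  rewrite mulr_sumr; apply: eq_bigr => i _; rewrite innerZr; ring.
rewrite tsum nuE innerZr in q2.
rewrite -(ler_pM2r p0) q1 in hess.
have {}q2 : 'd (radial_grad g2 (t *: v)) (t *: X) (t *: v) * inner (nu1 X) X =
    - (t * \sum_i k2 0 i * inner (f i) v ^+ 2).
  by apply: (mulfI (lt0r_neq0 t_gt0)); rewrite mulrCA q2 mulrN mulrA -expr2.
by rewrite q2 lerN2 in hess.
Qed.

End Touching.

(** * Radial monotonicity and the maximal ratio *)

(** Here [phi] extends [f] differentiably across a possible endpoint [x] of [D]. The last hypothesis
    makes [x] an accumulation point of [D], so the filter is proper and its limit unique. *)
Lemma derive_within_eq (R : realType) (D : set R) (f phi : R -> R) (x : R) :
  derivable phi x 1 -> D x -> (forall y, D y -> f y = phi y) ->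
  (forall d : R, 0 < d -> exists h, [/\ h != 0, `|h| < d & D (x + h)]) ->
  derive_within D f x = derive1 phi x.
Proof.
move=> dphi Dx fphi Dacc.
have PF : ProperFilter (within [set h | D (x + h)] (0 : R)^').
  apply: Build_ProperFilter_ex => A /nbhs_ballP[e /= /Dacc[h [h0 he Dh]] eA].
  by exists h; apply: eA => //; rewrite /ball/= sub0r normrN.
apply: cvg_lim; first exact: Rhausdorff.
rewrite derive1E.
have cphi : (fun h : R => h^-1 * (phi (x + h) - phi x)) @ (0 : R)^' --> 'D_1 phi x.
  have -> : (fun h : R => h^-1 * (phi (x + h) - phi x)) =
      (fun h : R => h^-1 *: (phi (h *: 1 + x) - phi x)).
    by apply/funext => h; rewrite [_%:A]mulr1 (addrC h).
  exact: dphi.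
have cw : (fun h : R => h^-1 * (phi (x + h) - phi x)) @
    within [set h | D (x + h)] (0 : R)^' --> 'D_1 phi x.
  exact: cvg_within_filter.
apply: cvg_trans cw.
apply: near_eq_cvg; rewrite near_withinE; near=> h => Dh.
by rewrite !fphi.
Unshelve. all: by end_near. Qed.

Section RadialDecrease.
Variables (R : realType) (n : nat) (r1 r2 : R).
Variable (G : 'rV[R]_n.+1 -> 'rV[R]_n.+1 -> R).
Hypothesis r1_gt0 : 0 < r1.
Hypothesis G_smooth : smooth_on (@annulus R n r1 r2 `*` @esphere R n.+1)
  (fun p : 'rV[R]_n.+1 * 'rV[R]_n.+1 => G p.1 p.2).
Hypothesis G_decr : forall X N, annulus r1 r2 X -> esphere N ->
  radial_derive r1 r2 G X N < 0.

Lemma annulusE (X : 'rV[R]_n.+1) : annulus r1 r2 X <-> r1 <= enorm X < r2.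
Proof.
split=> [[Xr2 /negP]|/andP[Xr1 Xr2]]; first by rewrite -leNgt => ->.
by split=> //; apply/negP; rewrite -leNgt.
Qed.

(** The function [rho * G] has negative derivative along the ray from [X] to [t *: X]. Its end
    values are compared and the common factor [enorm X] is divided out. *)
Lemma radial_decrease X N (t : R) : annulus r1 r2 X -> annulus r1 r2 (t *: X) ->
  esphere N -> 1 < t -> t * G (t *: X) N < G X N.
Proof.
move=> AX AtX N1 t1; have [U [g [_ AU gC gE]]] := G_smooth.
have /annulusE/andP[Xr1 Xr2] := AX.
have t0 : 0 < t by rewrite (lt_trans _ t1).
have /annulusE := AtX; rewrite enormZ gtr0_norm// => /andP[tXr1 tXr2].
set d := enorm X in Xr1 Xr2 tXr1 tXr2 *.
have d0 : 0 < d by exact: lt_le_trans Xr1.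
(* Built from the smooth extension [g], this function has a two-sided derivative even at
   [rho = r1]. *)
pose phi (rho : R) := rho * g ((rho / d) *: X, N).
have enormd rho : 0 < rho -> enorm ((rho / d) *: X) = rho.
  by move=> rho0; rewrite enormZ gtr0_norm ?divr_gt0// -/d divfK// gt_eqF.
have inA rho : r1 <= rho < r2 -> annulus r1 r2 ((rho / d) *: X).
  move=> rhoI; apply/annulusE; rewrite enormd//.
  by case/andP: rhoI => [+ _]; exact: lt_le_trans.
have phiE rho : r1 <= rho < r2 -> rho * G ((rho / d) *: X) N = phi rho.
  move=> rhoI; rewrite /phi -gE// inE; split=> //=; exact: inA.
have dphi rho : r1 <= rho < r2 -> derivable phi rho 1.
  move=> rhoI; apply/derivable1_diffP; apply: differentiableM => //.
  apply: (@differentiable_comp _ _ _ _ (fun rho : R => ((rho / d) *: X, N)) g).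
    apply: differentiable_pair => //; apply: differentiableZl.
    exact: differentiableM.
  by apply: (gC 1%N).1; apply: AU; split=> //=; exact: inA.
have phi'_lt0 rho : r1 <= rho < r2 -> derive1 phi rho < 0.
  move=> rhoI; have [rr1 rr2] := andP rhoI.
  have rho0 : 0 < rho by exact: lt_le_trans rr1.
  suff <- : radial_derive r1 r2 G ((rho / d) *: X) N = derive1 phi rho.
    by apply: G_decr => //; exact: inA.
  rewrite /radial_derive enormd//; apply: derive_within_eq => //.
  - exact: dphi.
  - move=> y yI; rewrite -phiE// scalerA mulrA divfK// gt_eqF//.
  (* A step to the right stays in the half-open interval, also from [rho = r1]; the halves keep both
     bounds strict. *)
  - move=> e e0; pose h := Num.min (e / 2) ((r2 - rho) / 2).
    have h0 : 0 < h by rewrite lt_min !divr_gt0// subr_gt0.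
    exists h; split; first by rewrite gt_eqF.
      by rewrite gtr0_norm// gt_min ltr_pdivrMr// ltr_pMr// ltr1n.
    rewrite /=; apply/andP; split; first by rewrite (le_trans rr1)// lerDl ltW.
    rewrite -ltrBrDl gt_min; apply/orP; right.
    by rewrite ltr_pdivrMr// ltr_pMr ?subr_gt0// ltr1n.
have dltd : d < t * d by rewrite ltr_pMl.
have sub rho : rho \in `[d, t * d]%R -> r1 <= rho < r2.
  rewrite in_itv/= => /andP[drho rhot].
  by rewrite (le_trans Xr1)//= (le_lt_trans rhot).
have := @ltr0_derive1_decr R phi d (t * d)
  (fun rho hr => dphi rho (sub rho (subset_itv_oo_cc hr)))
  (fun rho hr => phi'_lt0 rho (sub rho (subset_itv_oo_cc hr)))
  (derivable_within_continuous (fun rho hr => dphi rho (sub rho hr)))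
  d (t * d) (lexx _) dltd (lexx _).
rewrite -!phiE; last 2 first.
- by rewrite Xr1.
- by rewrite tXr1.
rewrite divff ?gt_eqF// scale1r mulfK ?gt_eqF//.
by rewrite mulrAC mulrC ltr_pM2l.
Qed.

End RadialDecrease.

(** Boundedness refers to the sup norm, so each coordinate is bounded by the Euclidean norm.
    Closedness comes from the continuous function [inner u u]. *)
Lemma esphere_compact (R : realType) (n : nat) : compact (@esphere R n).
Proof.
apply: bounded_closed_compact.
  exists 1; split=> // r r1 u u1; rewrite /= [leLHS]/Num.Def.normr/= mx_normrE.
  apply: (bigmax_le _ (ltW (lt_trans ltr01 r1))) => -[i j] _ /=.
  apply: le_trans (ltW r1); rewrite (ord1 i).
  have : `|u 0 j| ^+ 2 <= 1 ^+ 2.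
    rewrite real_normK ?num_real// -(congr1 (fun r => r ^+ 2) u1) enorm_sqr.
    rewrite /inner (bigD1 j)//= -expr2 lerDl; apply: sumr_ge0 => k _.
    by rewrite -expr2 sqr_ge0.
  by rewrite ler_pXn2r// nnegrE.
have -> : @esphere R n = (fun u => inner u u) @^-1` [set 1].
  apply/seteqP; split=> u /=; rewrite /esphere/= -enorm_sqr.
    by move=> ->; exact: expr1n.
  by move/eqP; rewrite -[X in _ == X](expr1n _ 2) eqrXn2 ?sqrtr_ge0// => /eqP.
apply: preimage_closed => [u _|].
  by apply: differentiable_continuous; exact: differentiable_inner_sqr.
exact: closed_eq.
Qed.

Lemma max_ratio (R : realType) (n : nat) (U1 U2 : set 'rV[R]_n.+1)
    (g1 g2 : 'rV[R]_n.+1 -> R) :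
  @esphere R n.+1 `<=` U1 -> Ck 2 U1 g1 -> @esphere R n.+1 `<=` U2 -> Ck 2 U2 g2 ->
  (forall z, esphere z -> 0 < g1 z) ->
  exists2 z, esphere z & forall y, esphere y -> g2 y / g1 y <= g2 z / g1 z.
Proof.
move=> S1 C1 S2 C2 g1_gt0.
have [||z zS zmax] := @EVT_max_rV R n.+1 (fun z => g2 z / g1 z)
  (@esphere R n.+1) _ (@esphere_compact R n.+1).
- exists (delta_mx 0 0); rewrite /esphere/= /enorm.
  suff -> : inner (delta_mx 0 0 : 'rV[R]_n.+1) (delta_mx 0 0) = 1 by rewrite sqrtr1.
  rewrite /inner (bigD1 0)//= big1 => [|i /negPf i0]; rewrite !mxE ?eqxx/=.
    by rewrite mulr1 addr0.
  by rewrite i0 mulr0.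
- apply: continuous_in_subspaceT => z; rewrite inE => zS.
  apply: differentiable_continuous; apply: differentiableM.
    by apply: C2.1; exact: S2.
  apply: differentiableV; first by apply: C1.1; exact: S1.
  by rewrite gt_eqF// g1_gt0.
by exists z => [|y yS]; [rewrite inE in zS|apply: zmax; rewrite inE].
Qed.

(** * Comparison of solutions *)

(** The radius function is traded for its C^2 extension [g], which agrees with it on the sphere;
    homogeneity then places [M] in the level set 1 of [radial_fun g]. *)
Lemma solution_level_set (R : realType) (n : nat) (Gamma : set 'rV[R]_n)
    (F : 'rV[R]_n -> R) (r1 r2 : R) (G : 'rV[R]_n.+1 -> 'rV[R]_n.+1 -> R)
    (M : set 'rV[R]_n.+1) :
  star_shaped_solution Gamma F r1 r2 G M ->
  exists nu U g, [/\ radial_level_set M nu U g,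
    forall z, esphere z -> 0 < g z /\ M (g z *: z),
    M `<=` annulus r1 r2 &
    forall X, M X -> exists2 k, principal_curvatures M nu X k &
      Gamma k /\ F k = G X (nu X)].
Proof.
move=> [nu [_ MA nuO [[rho [[U [g [_ SU gC rhog]]] rho0 ME]] star] curv]].
have gE z : esphere z -> g z = rho z by move=> zS; rewrite -rhog// inE.
exists nu, U, g; split=> //; last 2 first.
- by move=> z zS; rewrite gE//; split; [exact: rho0|rewrite ME; exists z].
- by move=> X /curv[k [? ? ?]]; exists k.
split=> //.
- move=> Y; rewrite {1}ME => -[z zS <-]; have r0 := rho0 z zS.
  rewrite scaler_eq0 gt_eqF//= esphere_neq0//; split=> //.
  by rewrite radial_funZ// radial_fun_sphere// gE// mulVf// gt_eqF.
- by move=> Y /nuO[nu1 _ _]; rewrite -enorm_sqr nu1 expr1n.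
- by move=> Y v /nuO[_ nuT _] /nuT.
- by move=> Y /curv[k [? _ _]]; exists k.
Qed.

Section Comparison.
Variables (R : realType) (n : nat) (Gamma : set 'rV[R]_n) (F : 'rV[R]_n -> R).
Hypothesis Gamma_cone : is_cone Gamma.
Hypothesis Gamma_sym : symmetric_set Gamma.
Hypothesis F_sym : symmetric_on Gamma F.
Hypothesis F_hom : homogeneous1_on Gamma F.
Hypothesis F_incr : increasing_on Gamma F.
Variables (r1 r2 : R) (G : 'rV[R]_n.+1 -> 'rV[R]_n.+1 -> R).
Hypothesis r1_gt0 : 0 < r1.
Hypothesis G_smooth : smooth_on (@annulus R n r1 r2 `*` @esphere R n.+1)
  (fun p : 'rV[R]_n.+1 * 'rV[R]_n.+1 => G p.1 p.2).
Hypothesis G_decr : forall X N, annulus r1 r2 X -> esphere N ->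
  radial_derive r1 r2 G X N < 0.

Lemma solution_ratio_le1 (M1 M2 : set 'rV[R]_n.+1) X (t : R) :
  star_shaped_solution Gamma F r1 r2 G M1 ->
  star_shaped_solution Gamma F r1 r2 G M2 ->
  0 < t -> M1 X -> M2 (t *: X) -> t <= 1.
Proof.
move=> /solution_level_set[nu1 [U1 [g1 [L1 g1M M1A curv1]]]].
move=> /solution_level_set[nu2 [U2 [g2 [L2 g2M M2A curv2]]]] t0 MX MtX.
have [z zS zmax] := max_ratio (level_sphere L1) (level_C2 L1) (level_sphere L2)
  (level_C2 L2) (fun z zS => (g1M z zS).1).
have [g1z M1z] := g1M z zS; have [g2z M2z] := g2M z zS.
set T := g2 z / g1 z in zmax; have T0 : 0 < T by rewrite divr_gt0.
have inside Y : Y != 0 -> radial_fun g2 Y <= T * radial_fun g1 Y.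
  move=> Y0; have PS := esphere_proj Y0.
  rewrite mulrCA ler_pM2l ?invr_gt0 ?enorm_gt0//.
  by rewrite -ler_pdivrMr ?zmax//; exact: (g1M _ PS).1.
(* At [X] the first level function is 1 and the second is [t], by homogeneity from its value 1 at
   [t *: X]. *)
have leT : t <= T.
  have [X0 h1] := level_eq1 L1 MX; have [_ h2] := level_eq1 L2 MtX.
  have := inside X X0; rewrite h1 mulr1; apply: le_trans.
  rewrite radial_funZ// in h2.
  by rewrite -[leRHS](mulVKf (lt0r_neq0 t0)) h2 mulr1.
apply: le_trans leT _; rewrite leNgt; apply/negP => T1.
(* [Z] and [T *: Z] are the points of [M1] and [M2] over the direction [z] of maximal ratio, where
   the touching occurs. *)
pose Z := g1 z *: z.
have TZ : T *: Z = g2 z *: z by rewrite scalerA divfK// gt_eqF.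
have M2Z : M2 (T *: Z) by rewrite TZ.
have insideT Y : Y != 0 -> radial_fun g2 (T *: Y) <= radial_fun g1 Y.
  by move=> Y0; rewrite radial_funZ// ler_pdivrMl// inside.
have [k1 pc1 [Gk1 Fk1]] := curv1 Z M1z.
have [k2 pc2 [Gk2 Fk2]] := curv2 (T *: Z) M2Z.
have [s1 [s2 lek]] := touching_curvatures L1 L2 T0 M1z M2Z insideT pc1 pc2.
(* Symmetry of [F] absorbs both sorting permutations, and homogeneity pulls out [T]. Through the two
   equations this contradicts [radial_decrease]. *)
have : F k1 <= T * F k2.
  rewrite -(F_sym s1 Gk1) -(F_sym s2 Gk2) -F_hom//; last exact: Gamma_sym.
  by apply: F_incr => //; [exact: Gamma_sym|apply: Gamma_cone => //; exact: Gamma_sym].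
rewrite Fk1 Fk2 (touching_normal L1 L2 T0 M1z M2Z insideT) leNgt => /negP; apply.
apply: (radial_decrease r1_gt0 G_smooth G_decr) => //.
- exact: M1A.
- exact: M2A.
- by rewrite /esphere/= /enorm (level_unit L1)// sqrtr1.
Qed.

(** The point of [M2] over the direction of [X] is some [t *: X]. The ratio bound, used once in each
    order of the two solutions, gives [t <= 1] and [t^-1 <= 1]. *)
Lemma solution_subset (M1 M2 : set 'rV[R]_n.+1) :
  star_shaped_solution Gamma F r1 r2 G M1 ->
  star_shaped_solution Gamma F r1 r2 G M2 -> M1 `<=` M2.
Proof.
move=> sol1 sol2 X M1X.
have [nu1 [U1 [g1 [L1 _ _ _]]]] := solution_level_set sol1.
have [X0 _] := level_eq1 L1 M1X.
have [nu2 [U2 [g2 [_ g2M _ _]]]] := solution_level_set sol2.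
have [r0 M2r] := g2M _ (esphere_proj X0).
rewrite /sphere_proj scalerA -/(sphere_proj X) in M2r.
set t := _ / _ in M2r.
have t0 : 0 < t by rewrite divr_gt0// enorm_gt0.
have t1 : t <= 1 by exact: solution_ratio_le1 sol1 sol2 t0 M1X M2r.
have tV1 : t^-1 <= 1.
  apply: (solution_ratio_le1 sol2 sol1 _ M2r); first by rewrite invr_gt0.
  by rewrite scalerA mulVf ?scale1r// gt_eqF.
rewrite invf_le1// in tV1.
have tE : t = 1 by apply/eqP; rewrite eq_le t1.
by rewrite tE scale1r in M2r.
Qed.

End Comparison.

Theorem theorem6p1 (R : realType) (n : nat)
    (Gamma : set 'rV[R]_n) (F : 'rV[R]_n -> R)
    (Gamma_open : open Gamma)
    (Gamma_convex : convex_set Gamma)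
    (Gamma_cone : is_cone Gamma)
    (Gamma_sym : symmetric_set Gamma)
    (Gamma_pos : @positive_cone R n `<=` Gamma)
    (F_sym : symmetric_on Gamma F)
    (F_pos : positive_on Gamma F)
    (F_hom : homogeneous1_on Gamma F)
    (F_incr : increasing_on Gamma F)
    (r1 r2 : R) (r1_gt0 : 0 < r1) (r1_lt_r2 : r1 < r2)
    (G : 'rV[R]_n.+1 -> 'rV[R]_n.+1 -> R)
    (G_smooth : smooth_on (@annulus R n r1 r2 `*` @esphere R n.+1)
                  (fun p : 'rV[R]_n.+1 * 'rV[R]_n.+1 => G p.1 p.2))
    (G_pos : forall X N, annulus r1 r2 X -> esphere N ->
               0 < inner X N -> 0 < G X N)
    (G_decr : forall X N, annulus r1 r2 X -> esphere N ->
                radial_derive r1 r2 G X N < 0)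
    (M1 M2 : set 'rV[R]_n.+1)
    (M1_sol : star_shaped_solution Gamma F r1 r2 G M1)
    (M2_sol : star_shaped_solution Gamma F r1 r2 G M2) :
  M1 = M2.
Proof.
by apply/seteqP; split; exact: (solution_subset Gamma_cone Gamma_sym F_sym F_hom
  F_incr r1_gt0 G_smooth G_decr).
Qed.
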